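(* Let $\alpha$ be an infinite ordinal. Then $$WSA_\alpha=\mathbf{Mod}(\Sigma_\alpha)=\mathbf{HSP}\{\wp({}^\alpha\alpha^{(Id)})\}=\mathbf{SP}\{\wp({}^\alpha U):U\text{ a set}\}.$$
   Context: For distinct $i,j\in\alpha$, $[i,j]$ is the transposition of $\alpha$ swapping $i$ and $j$, and $[i|j]$ is the map $\alpha\to\alpha$ sending $i$ to $j$ and fixing everything else. ${}^\alpha\alpha^{(Id)}=\{s\in{}^\alpha\alpha:|\{i\in\alpha:s_i\ne i\}|<\omega\}$. A set $V$ of $\alpha$-sequences is locally square if $s\circ[i|j],\,s\circ[i,j]\in V$ for all $s\in V$ and $i\neq j\in\alpha$; then $\wp(V)=\langle\mathcal P(V);\cap,\sim,S^i_j,S_{ij}\rangle_{i\ne j\in\alpha}$ with $\sim$ complement in $V$, $S^i_j(X)=\{q\in V:q\circ[i|j]\in X\}$ and $S_{ij}(X)=\{q\in V:q\circ[i,j]\in X\}$. $WSA_\alpha$ is the variety generated by all $\wp(V)$ with $V\subseteq{}^\alpha\alpha^{(Id)}$ locally square. Closure under isomorphic copies is understood in $\mathbf S,\mathbf P,\mathbf H$. For finite $n\geq 2$, $\Sigma_n$ is the following finite set of equations in the type $\{\cdot,-,s^i_j,s_{ij}\}_{i\ne j\in n}$: (a) the Boolean algebra axioms; (b) each $s_{ij}$ and each $s^i_j$ is a Boolean endomorphism; (c) for a fixed finite presentation of the monoid ${}^nn$ (all maps $n\to n$ under composition) in the generators $[i,j],[i|j]$, all equations $s_{g_1}\cdots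 s_{g_m}x=s_{h_1}\cdots s_{h_k}x$ for the defining relations $g_1\circ\cdots\circ g_m=h_1\circ\cdots\circ h_k$, where $s_{[i,j]}=s_{ij}$, $s_{[i|j]}=s^i_j$. $\Sigma_\alpha$ is the set of all equations in the type $\{\cdot,-,s^i_j,s_{ij}\}_{i\neq j\in\alpha}$ obtained from equations in $\Sigma_n$, $2\le n<\omega$, by replacing the indices along an injection $\rho:n\to\alpha$. *)

(* Defs.v *)
From Stdlib Require List.
From mathcomp Require Import all_boot all_order.
From mathcomp Require Import boolp classical_sets functions cardinality wochoice.

Set Implicit Arguments.
Unset Strict Implicit.
Unset Printing Implicit Defensive.

Local Open Scope classical_set_scope.

(* [Repl i j] stands for [i|j], [Trans i j] for [i,j]; both need [i != j].
   The operations s^i_j and s_ij of an algebra are indexed by these too. *)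
Inductive gen (I : eqType) : Type :=
| Repl (i j : I) of i != j
| Trans (i j : I) of i != j.

Definition gen_fun (I : eqType) (g : gen I) : I -> I :=
  match g with
  | Repl i j _ => fun k => if k == i then j else k
  | Trans i j _ => fun k => if k == i then j else if k == j then i else k
  end.

Definition gen_map (I J : eqType) (rho : I -> J) (rho_inj : injective rho)
    (g : gen I) : gen J :=
  match g with
  | Repl i j ij => Repl (contra_neq (@rho_inj i j) ij)
  | Trans i j ij => Trans (contra_neq (@rho_inj i j) ij)
  end.

Definition word (I : eqType) := seq (gen I).

(* [:: g1; ...; gm] denotes g1 \o ... \o gm, the empty word the identity. *)
Definition word_fun (I : eqType) (w : word I) : I -> I :=
  foldr (fun g f => gen_fun g \o f) id w.

Definition relations (n : nat) := seq (word 'I_n * word 'I_n).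

(* The congruence generated by [R] on the free monoid over the generators. *)
Inductive word_cong n (R : relations n) : word 'I_n -> word 'I_n -> Prop :=
| wc_rel p q u v : List.In (u, v) R -> word_cong R (p ++ u ++ q) (p ++ v ++ q)
| wc_refl u : word_cong R u u
| wc_sym u v : word_cong R u v -> word_cong R v u
| wc_trans u v w : word_cong R u v -> word_cong R v w -> word_cong R u w.

Definition presents_transformations n (R : relations n) : Prop :=
  (forall f : 'I_n -> 'I_n, exists w, word_fun w =1 f) /\
  (forall u v, word_cong R u v <-> word_fun u =1 word_fun v).

Record algebra (I : eqType) := Algebra {
  carrier :> Type;
  carrier_inh : inhabited carrier;
  mul : carrier -> carrier -> carrier;
  neg : carrier -> carrier;
  subst : gen I -> carrier -> carrier
}.

Definition is_hom (I : eqType) (A B : algebra I) (f : A -> B) : Prop :=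
  [/\ forall x y, f (mul x y) = mul (f x) (f y),
      forall x, f (neg x) = neg (f x)
    & forall g x, f (subst g x) = subst g (f x)].

Lemma prod_inh (I : eqType) (T : Type) (F : T -> algebra I) :
  inhabited (forall t, F t).
Proof.
have ex t : exists x : F t, True by case: (carrier_inh (F t)) => x; exists x.
exact: (inhabits (fun t => sval (cid (ex t)))).
Qed.

Definition prod_alg (I : eqType) (T : Type) (F : T -> algebra I) : algebra I :=
  @Algebra I (forall t, F t) (prod_inh F)
    (fun x y t => mul (x t) (y t))
    (fun x t => neg (x t))
    (fun g x t => subst g (x t)).

(* Not [set (algebra I)]: [wp] below puts carriers of algebras above the
   universe of [set], and [algebra I] itself lies strictly above carriers. *)
Definition alg_class (I : eqType) := algebra I -> Prop.

Definition same_class (I : eqType) (K L : alg_class I) : Prop :=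
  forall A, K A <-> L A.

Notation "K ≡ L" := (same_class K L) (at level 70, no associativity).

Definition subclass (I : eqType) (K L : alg_class I) : Prop :=
  forall A, K A -> L A.

Definition opH (I : eqType) (K : alg_class I) : alg_class I := fun A =>
  exists B, K B /\ exists f : B -> A, is_hom f /\ (forall a, exists b, f b = a).

Definition opS (I : eqType) (K : alg_class I) : alg_class I := fun A =>
  exists B, K B /\ exists f : A -> B, is_hom f /\ injective f.

Definition opP (I : eqType) (K : alg_class I) : alg_class I := fun A =>
  exists (T : Type) (F : T -> algebra I), (forall t, K (F t)) /\
    exists f : A -> prod_alg F, is_hom f /\ bijective f.

Definition is_variety (I : eqType) (K : alg_class I) : Prop :=
  [/\ subclass (opH K) K, subclass (opS K) K & subclass (opP K) K].

Definition variety_generated (I : eqType) (K : alg_class I) : alg_class I :=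
  fun A => forall V : alg_class I, is_variety V -> subclass K V -> V A.

Inductive term (I : eqType) : Type :=
| Var (k : nat)
| Mul (s t : term I)
| Neg (t : term I)
| Subst (g : gen I) (t : term I).

Arguments Var {I} k.

Definition equation (I : eqType) := (term I * term I)%type.

Fixpoint eval (I : eqType) (A : algebra I) (e : nat -> A) (t : term I) : A :=
  match t with
  | Var k => e k
  | Mul s t => mul (eval e s) (eval e t)
  | Neg t => neg (eval e t)
  | Subst g t => subst g (eval e t)
  end.

Definition holds (I : eqType) (A : algebra I) (eq : equation I) : Prop :=
  forall e : nat -> A, eval e eq.1 = eval e eq.2.

Definition Mod (I : eqType) (E : set (equation I)) : alg_class I :=
  fun A => forall eq, E eq -> holds A eq.

Fixpoint term_map (I J : eqType) (rho : I -> J) (rho_inj : injective rho)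
    (t : term I) : term J :=
  match t with
  | Var k => Var k
  | Mul s t => Mul (term_map rho_inj s) (term_map rho_inj t)
  | Neg t => Neg (term_map rho_inj t)
  | Subst g t => Subst (gen_map rho_inj g) (term_map rho_inj t)
  end.

Definition eqn_map (I J : eqType) (rho : I -> J) (rho_inj : injective rho)
    (eq : equation I) : equation J :=
  (term_map rho_inj eq.1, term_map rho_inj eq.2).

Definition word_term (I : eqType) (w : word I) (t : term I) : term I :=
  foldr (@Subst I) t w.

Definition Join (I : eqType) (s t : term I) : term I :=
  Neg (Mul (Neg s) (Neg t)).

(* In the type {., -}, join is the De Morgan dual of ., and the constants 0
   and 1 are x.-x and x+-x; the last six axioms state the laws of 0 and 1. *)
Definition boolean_axioms (I : eqType) : seq (equation I) :=
  let x := Var 0 in let y := Var 1 in let z := Var 2 in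
  [:: (Mul x y, Mul y x);
      (Join x y, Join y x);
      (Mul x (Mul y z), Mul (Mul x y) z);
      (Join x (Join y z), Join (Join x y) z);
      (Mul x (Join x y), x);
      (Join x (Mul x y), x);
      (Mul x (Join y z), Join (Mul x y) (Mul x z));
      (Join x (Mul y z), Mul (Join x y) (Join x z));
      (Neg (Neg x), x);
      (Mul x (Neg x), Mul y (Neg y));
      (Join x (Neg x), Join y (Neg y));
      (Join x (Mul y (Neg y)), x);
      (Mul x (Join y (Neg y)), x)].

Definition endomorphism_axioms (I : eqType) (g : gen I) : seq (equation I) :=
  let x := Var 0 in let y := Var 1 in
  [:: (Subst g (Mul x y), Mul (Subst g x) (Subst g y));
      (Subst g (Neg x), Neg (Subst g x))].

Definition relation_equation (I : eqType) (r : word I * word I) : equation I :=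
  (word_term r.1 (Var 0), word_term r.2 (Var 0)).

Definition Sigma_fin n (R : relations n) : set (equation 'I_n) :=
  [set eq | List.In eq (boolean_axioms 'I_n)] `|`
  [set eq | exists g, List.In eq (endomorphism_axioms g)] `|`
  [set eq | exists2 r, List.In r R & eq = relation_equation r].

Definition Sigma (R : forall n, relations n) (I : eqType) : set (equation I) :=
  [set eq | exists n, (2 <= n)%N /\
    exists (rho : 'I_n -> I) (rho_inj : injective rho),
    exists2 eq0, Sigma_fin (R n) eq0 & eq = eqn_map rho_inj eq0].

Arguments Sigma R I : clear implicits.

Definition locally_square (I : eqType) (U : Type) (V : set (I -> U)) : Prop :=
  forall s, V s -> forall g : gen I, V (s \o gen_fun g).

Definition subsets (I : eqType) (U : Type) (V : set (I -> U)) :=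
  {X : set (I -> U) | X `<=` V}.

Lemma wp_inh (I : eqType) (U : Type) (V : set (I -> U))
    : inhabited (subsets V).
Proof. by constructor; exists V. Qed.

Definition mk_subset (I : eqType) (U : Type) (V : set (I -> U))
    (X : set (I -> U)) (XV : X `<=` V) : subsets V :=
  exist (fun X => X `<=` V) X XV.

Definition wp_mul (I : eqType) (U : Type) (V : set (I -> U))
    (X Y : subsets V) : subsets V :=
  @mk_subset _ _ V (sval X `&` sval Y)
    (subset_trans (@subIsetl _ _ _) (svalP X)).

Definition wp_neg (I : eqType) (U : Type) (V : set (I -> U))
    (X : subsets V) : subsets V :=
  @mk_subset _ _ V (V `\` sval X) (@subDsetl _ _ _).

Definition wp_subst (I : eqType) (U : Type) (V : set (I -> U))
    (g : gen I) (X : subsets V) : subsets V :=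
  @mk_subset _ _ V (V `&` [set q : I -> U | sval X (q \o gen_fun g)])
    (@subIsetl _ _ _).

(* Meaningful for every V, but only used for locally square V. *)
Definition wp (I : eqType) (U : Type) (V : set (I -> U)) : algebra I :=
  @Algebra I (subsets V) (wp_inh V) (@wp_mul I U V) (@wp_neg I U V)
    (@wp_subst I U V).

Definition Id_space (I : eqType) : set (I -> I) :=
  [set s | finite_set [set i | s i <> i]].

Arguments Id_space I : clear implicits.

Definition WSA (I : eqType) : alg_class I :=
  variety_generated (fun A => exists V : set (I -> I),
    [/\ V `<=` Id_space I, locally_square V & A = wp V]).

Definition wp_Id_class (I : eqType) : alg_class I :=
  fun A => A = wp (Id_space I).

Definition full_wp_class (I : eqType) : alg_class I :=
  fun A => exists U : Type, A = wp [set: I -> U].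

Arguments WSA I : clear implicits.
Arguments wp_Id_class I : clear implicits.
Arguments full_wp_class I : clear implicits.

(* Main.v *)
(** In a model of [Sigma R I], the presentations make the operation [s_f]
    well defined for every map [f : I -> I] that moves finitely many points.
    Let [F] be an ultrafilter of the model, and for [q : I -> I] and a finite
    [s] let [q_s] be [q] on [s] and the identity elsewhere.  If [D] is an
    ultrafilter of finite sets containing every tail, then
    [x |-> {q | s_(q_s) x belongs to F for D-almost all s}] is a homomorphism
    into the full set algebra [wp setT], because [q_s o g = (q o g)_s] as soon
    as [s] contains the indices of [g].  Its value at [x] contains [id] exactly
    when [x] is in [F], so these maps separate points, and still do after
    restriction to the locally square set [Id_space I]. *)

Require Import Defs.
From mathcomp Require Import all_boot all_order.
From mathcomp Require Import boolp classical_sets functions cardinality wochoice.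
From mathcomp Require Import filter.

Set Implicit Arguments.
Unset Strict Implicit.
Unset Printing Implicit Defensive.

Local Notation mul := Defs.mul.

(** * Class operators and equational classes *)

Section Classes.

Variable I : eqType.
Implicit Types (A B : algebra I) (K : alg_class I) (E : set (equation I)).

Lemma eval_hom A B (f : A -> B) (e : nat -> A) t :
  is_hom f -> f (eval e t) = eval (f \o e) t.
Proof.
by case=> fM fN fS; elim: t => //= [s <- t <-|t <-|g t <-].
Qed.

Lemma eval_prod (T : Type) (F : T -> algebra I) (e : nat -> prod_alg F) t i :
  eval e t i = eval (fun k => e k i) t.
Proof. by elim: t => //= [s -> t ->|t ->|g t ->]. Qed.

Lemma is_hom_id A : is_hom (@id A).
Proof. by []. Qed.

Lemma is_hom_comp A B (C : algebra I) (f : A -> B) (g : B -> C) :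
  is_hom f -> is_hom g -> is_hom (g \o f).
Proof.
move=> [fM fN fS] [gM gN gS].
by split=> *; rewrite /= ?fM ?gM ?fN ?gN ?fS ?gS.
Qed.

Lemma opH_Mod E : subclass (opH (Mod E)) (Mod E).
Proof.
move=> A [B [BE [f [fhom fsurj]]]] eq Eeq e.
have /choice [e' e'E] : forall k, exists b, f b = e k by move=> k; exact: fsurj.
have <- : f \o e' = e by apply/funext.
by rewrite -!(eval_hom _ _ fhom) BE.
Qed.

Lemma opS_Mod E : subclass (opS (Mod E)) (Mod E).
Proof.
move=> A [B [BE [f [fhom finj]]]] eq Eeq e.
by apply: finj; rewrite !(eval_hom _ _ fhom) BE.
Qed.

Lemma opP_Mod E : subclass (opP (Mod E)) (Mod E).
Proof.
move=> A [T [F [FE [f [fhom fbij]]]]] eq Eeq e.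
apply: (bij_inj fbij); rewrite !(eval_hom _ _ fhom).
by apply: functional_extensionality_dep => i; rewrite !eval_prod FE.
Qed.

Lemma Mod_variety E : is_variety (Mod E).
Proof. by split; [exact: opH_Mod|exact: opS_Mod|exact: opP_Mod]. Qed.

Lemma opS_mono K L : subclass K L -> subclass (opS K) (opS L).
Proof. by move=> KL A [B [KB fP]]; exists B; split=> //; exact: KL. Qed.

Lemma opH_mono K L : subclass K L -> subclass (opH K) (opH L).
Proof. by move=> KL A [B [KB fP]]; exists B; split=> //; exact: KL. Qed.

Lemma opP_mono K L : subclass K L -> subclass (opP K) (opP L).
Proof.
by move=> KL A [T [F [KF fP]]]; exists T, F; split=> // t; exact: KL.
Qed.

Lemma subclass_opH K : subclass K (opH K).
Proof.
by move=> A KA; exists A; split=> //; exists id; split=> // a; exists a.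
Qed.

Lemma opHSP_variety K V :
  is_variety V -> subclass K V -> subclass (opH (opS (opP K))) V.
Proof.
move=> [VH VS VP] KV A; move/(opH_mono (opS_mono (opP_mono KV))).
by move/(opH_mono (opS_mono VP)) => /(opH_mono VS) /VH.
Qed.

Lemma opSP_variety K V :
  is_variety V -> subclass K V -> subclass (opS (opP K)) V.
Proof. by move=> [_ VS VP] KV A /(opS_mono (opP_mono KV)) /(opS_mono VP) /VS. Qed.

(** The power of [B] is indexed by all homomorphisms from [A] to [B], and [A] maps into it by
    evaluation. A one-point [A] is covered even if this index type is empty. *)
Lemma opSP_separated K A B :
  K B ->
  (forall x y : A, x <> y -> exists2 f : A -> B, is_hom f & f x <> f y) ->
  opS (opP K) A.
Proof.
move=> KB sep; pose F (_ : {f : A -> B | is_hom f}) := B.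
exists (prod_alg F); split.
  by exists _, F; split=> //; exists id; split; [exact: is_hom_id|exists id].
exists (fun x f => sval f x); split.
  by split=> *; apply: functional_extensionality_dep => -[f [fM fN fS]] /=.
move=> x y; apply: contraPP => /sep[f fhom fxy] fE.
by apply: fxy; have := congr1 (fun z => z (exist _ f fhom)) fE.
Qed.

End Classes.

(** * Boolean arithmetic and ultrafilters *)

Section Boolean.

Local Open Scope classical_set_scope.

Variables (I : eqType) (A : algebra I).
Hypothesis boolA : forall eq, List.In eq (boolean_axioms I) -> holds A eq.
Implicit Types x y z : A.

Let join x y := neg (mul (neg x) (neg y)).
Let zero x := mul x (neg x).

Let env x y z (k : nat) := nth x [:: x; y; z] k.

(** [n] is a zero-based position in [boolean_axioms]: 0 and 2 are commutativity and associativity of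
    meet, 4 and 5 absorption, 6 distributivity, 9 the uniqueness of zero, 11 and 12 the laws of zero
    and one. *)
Ltac boolean_axiom n x y z :=
  have := @boolA (List.nth n (boolean_axioms I) (Var 0, Var 0))
    (ltac:(simpl; tauto)) (env x y z); rewrite /env /=.

Lemma mulC x y : mul x y = mul y x.
Proof. by boolean_axiom 0 x y x. Qed.

Lemma mulA x y z : mul x (mul y z) = mul (mul x y) z.
Proof. by boolean_axiom 2 x y z. Qed.

(** The two absorption laws combine: [x + x.x] is [x], and [x.(x + x.x)] is [x]. *)
Lemma mulxx x : mul x x = x.
Proof.
have joinK u v : join u (mul u v) = u by boolean_axiom 5 u v u.
by boolean_axiom 4 x (mul x x) x; rewrite -/(join _ _) joinK.
Qed.

Lemma mulN_const x y : mul x (neg x) = mul y (neg y).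
Proof. by boolean_axiom 9 x y x. Qed.

Lemma mul_zero x y : mul x (zero y) = zero y.
Proof. by rewrite /zero -(mulN_const x) mulA mulxx. Qed.

Lemma mul_split x y : x = join (mul x y) (mul x (neg y)).
Proof.
boolean_axiom 12 x y x => {1}<-.
by boolean_axiom 6 x y (neg y).
Qed.

Lemma mul_split0 x y z : mul x (neg y) = zero z -> mul x y = x.
Proof.
move=> xNy; rewrite [RHS](mul_split x y) xNy.
by boolean_axiom 11 (mul x y) z z.
Qed.

Lemma mul_neq0 x y : x <> y ->
  mul x (neg y) <> zero x \/ mul y (neg x) <> zero x.
Proof.
move=> xy; have [/mul_split0 xE|] := pselect (mul x (neg y) = zero x); last by left.
right=> /mul_split0 yE; apply: xy.
by rewrite -xE mulC.
Qed.

(* Maximal among the multiplicatively closed sets whose elements all meet [a]. *)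
Lemma ultrafilter_exists (a : A) : a <> zero a ->
  exists F : set A, [/\ F a, forall x y, F (mul x y) <-> F x /\ F y
    & forall x, F (neg x) <-> ~ F x].
Proof.
move=> a0; pose P : set (set A) := [set F | (forall x y, F x -> F y -> F (mul x y))
  /\ (forall x, F x -> mul x a <> zero a)].
have [|F [[FM F0] Fmax]] := @Zorn_bigcup A P.
  move=> C CP Ctot; split=> [x y [X CX Xx] [Y CY Yy]|x [X CX Xx]].
    have [XY|YX] := Ctot _ _ CX CY.
      by exists Y => //; apply: (CP _ CY).1 => //; exact: XY.
    by exists X => //; apply: (CP _ CX).1 => //; exact: YX.
  exact: (CP _ CX).2.
have FxP x : F x \/ mul x a = zero a \/ exists2 y, F y & mul (mul y x) a = zero a.
  have [Fx|nFx] := pselect (F x); [by left|right].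
  apply: contrapT => /not_orP[xa yxa].
  (* As [F] is closed under products and [x] is idempotent, this is the closure of [F] and [x] under
     products. *)
  pose G : set A := F `|` [set x] `|` [set mul y x | y in F].
  have FG : F `<` G.
    by split=> [y Fy|GF]; [left; left|apply/nFx/GF; left; right].
  apply: (Fmax _ FG); split; last first.
    move=> y [[/F0//|-> //]|[z Fz <-]] zx; apply: yxa; by exists z.
  have GM y z : F y -> G z -> G (mul y z).
    move=> Fy [[Fz|->]|[u Fu <-]]; first by left; left; exact: FM.
      by right; exists y.
    by right; exists (mul y u); [exact: FM|rewrite mulA].
  have Gx y : G y -> G (mul y x).
    move=> [[Fy| ->]|[u Fu <-]]; first by right; exists y.
      by rewrite mulxx; left; right.
    by rewrite -mulA mulxx; right; exists u.
  move=> y z [[Fy|->]|[u Fu <-]] Gz; first exact: GM.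
    by rewrite mulC; exact: Gx.
  by rewrite -mulA [mul x z]mulC; apply: GM => //; exact: Gx.
(* Maximality puts [a] in [F], as [a] is nonzero and meets every element of [F]. *)
have Fa : F a.
  have [//|[|[y Fy]]] := FxP a; first by rewrite mulxx.
  by rewrite -mulA mulxx => /F0.
have FN0 x y : F x -> x <> zero y.
  by move=> /F0 xa xE; apply: xa; rewrite xE mulC mul_zero /zero (mulN_const y a).
have {}FxP x : F x \/ exists2 y, F y & mul y x = zero a.
  have [|[xa|[y Fy yxa]]] := FxP x; [by left|right..].
    by exists a => //; rewrite mulC.
  by exists (mul a y); [exact: FM|rewrite -mulA mulC].
have FMl x y : F (mul x y) -> F x.
  move=> Fxy; have [//|[z Fz zx]] := FxP x.
  by have /FN0 := FM _ _ Fz Fxy; case/(_ a); rewrite mulA zx mulC mul_zero.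
exists F; split=> // [x y|x].
  split=> [Fxy|[Fx Fy]]; last exact: FM.
  by split; [exact: FMl Fxy|apply: (FMl y x); rewrite mulC].
split=> [FNx Fx|nFx]; first by apply: (FN0 _ x (FM _ _ Fx FNx)).
(* If neither [x] nor its complement were in [F], some [y] and [z] in [F] would satisfy [y.-x = 0]
   and [z.x = 0]. Then [y = y.x], so [z.y = 0], although [z.y] lies in [F]. *)
have [//|[y Fy yNx]] := FxP (neg x).
have [//|[z Fz zx]] := FxP x.
case: (FN0 _ a (FM _ _ Fz Fy)).
have <- : mul y x = y by exact: mul_split0 yNx.
by rewrite mulA [mul z y]mulC -mulA zx mul_zero.
Qed.

End Boolean.

(** * Words over the generators and their transport along injections *)

Section Words.

Variables (I J : eqType) (rho : I -> J) (rho_inj : injective rho).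

Lemma gen_eqP (g h : gen J) :
  match g, h with
  | Repl i j _, Repl i' j' _ | Trans i j _, Trans i' j' _ => i = i' /\ j = j'
  | _, _ => False
  end -> g = h.
Proof.
by case: g h => [i j ij|i j ij] [i' j' ij'|i' j' ij'] //= [ii' jj'];
  move: ij ij'; rewrite ii' jj' => ij ij'; rewrite (bool_irrelevance ij ij').
Qed.

Lemma word_fun_cat (u v : word I) : word_fun (u ++ v) = word_fun u \o word_fun v.
Proof. by elim: u => //= g u ->. Qed.

Lemma gen_fun_map g i : gen_fun (gen_map rho_inj g) (rho i) = rho (gen_fun g i).
Proof. by case: g => a b ab /=; rewrite !(inj_eq rho_inj); do !case: ifP. Qed.

Lemma gen_fun_out g k : (forall i, rho i <> k) -> gen_fun (gen_map rho_inj g) k = k.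
Proof.
move=> rk; have rkF i : (k == rho i) = false by apply/eqP => /esym; exact: rk.
by case: g => a b ab /=; rewrite !rkF.
Qed.

Lemma word_fun_map w i :
  word_fun (map (gen_map rho_inj) w) (rho i) = rho (word_fun w i).
Proof. by elim: w => //= g w ->; rewrite gen_fun_map. Qed.

Lemma word_fun_out w k :
  (forall i, rho i <> k) -> word_fun (map (gen_map rho_inj) w) k = k.
Proof. by move=> rk; elim: w => //= g w ->; rewrite gen_fun_out. Qed.

(** On the range of [rho] a transported word acts as the original one, and off the range as the
    identity. *)
Lemma word_fun_map_eq u v : word_fun u =1 word_fun v ->
  word_fun (map (gen_map rho_inj) u) =1 word_fun (map (gen_map rho_inj) v).
Proof.
move=> uv k; have [[i <-]|rk] := pselect (exists i, rho i = k).
  by rewrite !word_fun_map uv.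
by rewrite !word_fun_out // => i ik; apply: rk; exists i.
Qed.

Definition gen_support (g : gen J) : seq J :=
  match g with Repl i j _ | Trans i j _ => [:: i; j] end.

Lemma gen_fun_notin g k : k \notin gen_support g -> gen_fun g k = k.
Proof.
case: g => i j ij; rewrite !inE negb_or /= => /andP[/negbTE-> kj] //.
by rewrite (negbTE kj).
Qed.

Lemma gen_fun_in g k : k \in gen_support g -> gen_fun g k \in gen_support g.
Proof.
by case: g => i j ij; rewrite !inE /= => /orP[]/eqP->; do !case: ifP;
  rewrite ?eqxx ?orbT.
Qed.

Definition word_support (w : word J) : seq J := flatten (map gen_support w).

(** Used to pull a word back to some ['I_n], where a presentation is available. *)
Lemma word_support_map (w : word J) :
  {in word_support w, forall k, exists i, rho i = k} ->
  exists w0, w = map (gen_map rho_inj) w0.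
Proof.
elim: w => [|g w IHw] gwP; first by exists [::].
have [w0 wE] : exists w0, w = map (gen_map rho_inj) w0.
  by apply: IHw => k kw; apply: gwP; rewrite /word_support /= mem_cat kw orbT.
have gP k : k \in gen_support g -> exists i, rho i = k.
  by move=> kg; apply: gwP; rewrite /word_support /= mem_cat kg.
suff [g0 gE] : exists g0, g = gen_map rho_inj g0 by exists (g0 :: w0); rewrite gE wE.
case: g gP {gwP} => i j ij gP.
- have [a ai] := gP i (mem_head _ _).
  have [b bj] : exists b, rho b = j by apply: gP; rewrite !inE eqxx orbT.
  have ab : a != b by rewrite -(inj_eq rho_inj) ai bj.
  by exists (Repl ab); apply: gen_eqP.
- have [a ai] := gP i (mem_head _ _).
  have [b bj] : exists b, rho b = j by apply: gP; rewrite !inE eqxx orbT.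
  have ab : a != b by rewrite -(inj_eq rho_inj) ai bj.
  by exists (Trans ab); apply: gen_eqP.
Qed.

Definition act (A : algebra J) (w : word J) (x : A) : A := foldr (@subst J A) x w.

Lemma act_cat (A : algebra J) u v (x : A) : act (u ++ v) x = act u (act v x).
Proof. exact: foldr_cat. Qed.

Lemma eval_word_term (A : algebra J) (e : nat -> A) w t :
  eval e (term_map rho_inj (word_term w t)) =
  act (map (gen_map rho_inj) w) (eval e (term_map rho_inj t)).
Proof. by elim: w => //= g w ->. Qed.

End Words.

Lemma wp_ext (I : eqType) (U : Type) (V : set (I -> U)) (X Y : wp V) :
  (forall q, V q -> sval X q <-> sval Y q) -> X = Y.
Proof.
move: X Y => [X XV] [Y YV] /= XY; apply/eq_exist/seteqP.
by split=> q qP; [have Vq := XV q qP|have Vq := YV q qP]; apply/XY.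
Qed.

(** * Finitely supported maps over an infinite index set *)

Section Infinite.

Variables (I : eqType) (R : forall n, relations n).
Hypothesis I_inf : infinite_set [set: I]%classic.
Hypothesis R_pres : forall n, (2 <= n)%N -> presents_transformations (R n).

Lemma fresh (s : seq I) : exists i, i \notin s.
Proof.
apply: contrapT => /forallNP sI; apply: I_inf.
apply: sub_finite_set (finite_seq s) => i _ /=.
by have /negP/negPn := sI i.
Qed.

Lemma finite_embedding (s : seq I) : exists n (rho : 'I_n -> I),
  [/\ (2 <= n)%N, injective rho & forall k, k \in s -> exists i, rho i = k].
Proof.
have [a aP] := fresh s; have [b bP] := fresh (a :: s).
(* The two fresh points make the length at least 2 even when [s] is empty; [undup] makes the
   enumeration injective. *)
pose l := [:: b, a & undup s].
have l_uniq : uniq l.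
  by move: bP aP; rewrite /= !inE !mem_undup undup_uniq => -> ->.
exists (size l), (tnth (in_tuple l)); split=> // [i j|k ks].
  by rewrite !(tnth_nth a) => /eqP; rewrite nth_uniq // => /eqP /val_inj.
have /(tnthP (in_tuple l)) [i ->] : k \in in_tuple l.
  by rewrite /= !inE mem_undup ks !orbT.
by exists i.
Qed.

Lemma word_exists (f : I -> I) (s : seq I) :
  (forall k, k \notin s -> f k = k) -> exists w, word_fun w =1 f.
Proof.
(* Adding the image of [s] makes [f] map the range of [rho] into itself, so that it is represented
   by a word over ['I_n]. *)
move=> fs; have [n [rho [n2 rho_inj rhoP]]] := finite_embedding (s ++ map f s).
have fP i : exists j, rho j = f (rho i).
  have [si|/fs ->] := boolP (rho i \in s); last by exists i.
  by apply: rhoP; rewrite mem_cat map_f ?orbT.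
have [f0 f0E] := choice fP; have [w wE] := (R_pres n2).1 f0.
exists (map (gen_map rho_inj) w) => k.
have [[i <-]|rk] := pselect (exists i, rho i = k).
  by rewrite word_fun_map wE f0E.
rewrite word_fun_out; last by move=> i ik; apply: rk; exists i.
by rewrite fs //; apply/negP => ks; apply/rk/rhoP; rewrite mem_cat ks.
Qed.

(** * Representation of models of [Sigma R I] *)

Section Models.

Variable A : algebra I.
Hypothesis AM : Mod (Sigma R I) A.

Lemma Sigma_holds n (rho : 'I_n -> I) (rho_inj : injective rho) eq :
  (2 <= n)%N -> Sigma_fin (R n) eq -> holds A (eqn_map rho_inj eq).
Proof.
by move=> n2 eqP; apply: AM; exists n; split=> //; exists rho, rho_inj, eq.
Qed.

Lemma model_boolean eq : List.In eq (boolean_axioms I) -> holds A eq.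
Proof.
have [n [rho [n2 rho_inj _]]] := finite_embedding [::].
(* No index occurs in the Boolean axioms, so transport along [rho] yields the same list. *)
have -> : boolean_axioms I = List.map (eqn_map rho_inj) (boolean_axioms 'I_n) by [].
by move=> /List.in_map_iff [eq0 [<- eq0P]]; apply: Sigma_holds => //; left; left.
Qed.

Lemma model_endomorphism g eq :
  List.In eq (endomorphism_axioms g) -> holds A eq.
Proof.
have [n [rho [n2 rho_inj rhoP]]] := finite_embedding (word_support [:: g]).
have [[|g0 []] // [->]] := word_support_map rho_inj rhoP.
have -> : endomorphism_axioms (gen_map rho_inj g0) =
  List.map (eqn_map rho_inj) (endomorphism_axioms g0) by [].
move=> /List.in_map_iff [eq0 [<- eq0P]]; apply: Sigma_holds => //.
by left; right; exists g0.
Qed.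

Lemma act_cong n (rho : 'I_n -> I) (rho_inj : injective rho) u v (x : A) :
  (2 <= n)%N -> word_cong (R n) u v ->
  act (map (gen_map rho_inj) u) x = act (map (gen_map rho_inj) v) x.
Proof.
move=> n2 uv; elim: uv x => // [p q {}u {}v uvR x|{}u {}v w _ uv _ vw x].
  rewrite !map_cat !act_cat; congr (act _ _).
  have /(_ (fun=> act (map (gen_map rho_inj) q) x)) :
      holds A (eqn_map rho_inj (relation_equation (u, v))).
    by apply: Sigma_holds => //; right; exists (u, v).
  by rewrite /= !eval_word_term.
by rewrite uv vw.
Qed.

(** Both words lift to a common ['I_n]; the lifts have the same map because [rho] is injective, and
    completeness of the presentation makes them congruent. *)
Lemma act_eq u v (x : A) : word_fun u =1 word_fun v -> act u x = act v x.
Proof.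
have [n [rho [n2 rho_inj rhoP]]] :=
  finite_embedding (word_support u ++ word_support v).
have [k ku|u0 ->] := @word_support_map _ _ _ rho_inj u.
  by apply: rhoP; rewrite mem_cat ku.
have [k kv|v0 ->] := @word_support_map _ _ _ rho_inj v.
  by apply: rhoP; rewrite mem_cat kv orbT.
move=> uv; apply: act_cong => //; apply/(R_pres n2).2 => i.
by apply: (rho_inj); rewrite -!(word_fun_map rho_inj) uv.
Qed.

Lemma act_mul w (x y : A) : act w (mul x y) = mul (act w x) (act w y).
Proof.
elim: w => //= g w ->.
have := @model_endomorphism g _ (or_introl erefl).
by move=> /(_ (fun k => if k is 0 then act w x else act w y)).
Qed.

Lemma act_neg w (x : A) : act w (neg x) = neg (act w x).
Proof.
elim: w => //= g w ->.
have := @model_endomorphism g _ (or_intror (or_introl erefl)).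
by move=> /(_ (fun=> act w x)).
Qed.

Definition patch (q : I -> I) (s : seq I) (k : I) : I := if k \in s then q k else k.

(** Under [g] a point of the support stays in the support, hence in [s]; every other point is
    fixed. *)
Lemma patch_gen q s g : {subset gen_support g <= s} ->
  patch q s \o gen_fun g =1 patch (q \o gen_fun g) s.
Proof.
move=> gs k; rewrite /patch /=; 
have [kg|/gen_fun_notin -> //] := boolP (k \in gen_support g).
by rewrite !gs ?gen_fun_in.
Qed.

Lemma patch_word q s : exists w, word_fun w =1 patch q s.
Proof. by apply: (@word_exists _ s) => k /negbTE ks; rewrite /patch ks. Qed.

Local Open Scope classical_set_scope.

(** The tails form a filter base: the tail of [s ++ t] lies in those of [s] and [t], and the tail of
    [s] contains [s]. *)
Lemma tail_ultrafilter : exists D : set_system (seq I), UltraFilter D /\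
  forall s : seq I, D [set t : seq I | {subset s <= t}].
Proof.
pose B (s : seq I) : set (seq I) := [set t : seq I | {subset s <= t}].
have BF : ProperFilter (filter_from setT B).
  apply: filter_from_proper => [|s _]; last by exists s => k.
  apply: filter_fromT_filter; first by exists [::].
  move=> s t; exists (s ++ t) => r rP.
  by split=> k ks; apply: rP; rewrite mem_cat ks ?orbT.
have [D [DU BD]] := ultraFilterLemma BF.
by exists D; split=> // s; apply: BD; exists s.
Qed.

Lemma full_representation (F : set A) :
  (forall x y, F (mul x y) <-> F x /\ F y) -> (forall x, F (neg x) <-> ~ F x) ->
  exists2 h : A -> wp [set: I -> I], is_hom h &
    forall x, sval (h x) id <-> F x.
Proof.
move=> FM FN; have [D [DU Dtail]] := tail_ultrafilter.
(* A word is fixed for each [q_s]; by [act_eq] the operation does not depend on the choice. *)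
have /choice [W WE] : forall qs : (I -> I) * seq I,
    exists w, word_fun w =1 patch qs.1 qs.2 by move=> qs; exact: patch_word.
pose H x : set (I -> I) := [set q | D [set s | F (act (W (q, s)) x)]].
have DN X : D (~` X) <-> ~ D X.
  split=> [DNX DX|nDX]; last by have [/nDX|] := in_ultra_setVsetC X DU.
  by apply: (@filter_not_empty _ D _); rewrite -(setICr X); exact: filterI.
exists (fun x => mk_subset (@subsetT _ (H x))).
  split=> [x y|x|g x]; apply: wp_ext => q _ /=; rewrite /H /=.
  - split=> [Dxy|[Dx Dy]].
      by split; apply: filterS Dxy => s; rewrite /= act_mul => /FM[].
    by apply: filterS (filterI Dx Dy) => s /= xy; rewrite act_mul; apply/FM.
  - have -> : [set s | F (act (W (q, s)) (neg x))] =
        ~` [set s | F (act (W (q, s)) x)].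
      by apply/seteqP; split=> s; rewrite /= act_neg FN.
    by rewrite DN; split=> // -[].
  (* For [s] containing the indices of [g], both sides come from words with the same map; these [s]
     form a set in [D], which suffices. *)
  - have HS s : {subset gen_support g <= s} ->
        act (W (q, s)) (subst g x) = act (W (q \o gen_fun g, s)) x.
      move=> gs; rewrite -[LHS](act_cat (W (q, s)) [:: g]); apply: act_eq => k.
      by rewrite word_fun_cat /= !WE; exact: patch_gen.
    split=> [Dq|[_ Dq]]; [split=> //|];
      apply: filterS (filterI (Dtail (gen_support g)) Dq) => s /= [gs];
      by rewrite HS.
move=> x; rewrite /= /H /=.
(* Every patch of [id] is [id], so this set is everything or empty. *)
have -> : [set s | F (act (W (id, s)) x)] = [set s | F x].
  apply/funext => s /=; rewrite (@act_eq _ [::]) // => k.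
  by rewrite WE /patch if_same.
split=> [/filter_ex[]//|Fx]; exact: filterE.
Qed.

(** One of the two differences of distinct elements is nonzero; an ultrafilter containing it
    contains exactly one of the elements. *)
Lemma separating_representation (x y : A) : x <> y ->
  exists2 h : A -> wp [set: I -> I], is_hom h & sval (h x) id <> sval (h y) id.
Proof.
have sep u v : mul u (neg v) <> mul x (neg x) ->
    exists2 h : A -> wp [set: I -> I], is_hom h & sval (h u) id /\ ~ sval (h v) id.
  rewrite (mulN_const model_boolean x (mul u (neg v))).
  move=> /(ultrafilter_exists model_boolean) [F [Fuv FM FN]].
  have [h hhom hE] := full_representation FM FN.
  by exists h => //; rewrite !hE -FN; apply/FM.
by move=> /(mul_neq0 model_boolean)[] /sep[h hhom [h1 h2]]; exists h => // hE;
  apply: h2; [rewrite -hE|rewrite hE].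
Qed.

End Models.

Local Open Scope classical_set_scope.

(** * Set algebras: restriction and soundness *)

Definition restrict (V : set (I -> I)) (X : wp [set: I -> I]) : wp V :=
  mk_subset (@subIsetl _ V (sval X)).

(** Local squareness serves the substitution case: [q \o gen_fun g] must lie in [V] for restriction
    to commute with it. *)
Lemma restrict_hom (V : set (I -> I)) :
  locally_square V -> is_hom (@restrict V).
Proof.
move=> Vsq; split=> [X Y|X|g X]; apply: wp_ext => q Vq /=; [tauto..|].
have := Vsq _ Vq g; tauto.
Qed.

(** The composite can move only the points moved by [s] and the finitely many in the support of
    [g]. *)
Lemma Id_space_locally_square : locally_square (Id_space I).
Proof.
move=> s sfin g.
have : finite_set ([set i | s i <> i] `|` [set` gen_support g]).
  by rewrite finite_setU; split=> //; exact: finite_seq.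
apply: sub_finite_set => i /= sgi.
have [|ig] := boolP (i \in gen_support g); [by right|left].
by move: sgi; rewrite gen_fun_notin.
Qed.

Lemma wp_Sigma (U : Type) (V : set (I -> U)) :
  locally_square V -> Mod (Sigma R I) (wp V).
Proof.
move=> Vsq eq [n [n2 [rho [rho_inj [eq0 eq0P ->]]]]] e.
have eS k q : sval (e k) q -> V q by exact: (svalP (e k)).
case: eq0P => [[eq0P|[g eq0P]]|[[u v] uvR ->]]; last first.
- have uv : word_fun u =1 word_fun v.
    by apply/(R_pres n2).2; rewrite -[u]cats0 -[v]cats0; exact: (wc_rel [::] [::]).
  (* Iterated preimages compose, so a word acts by precomposition with its map, and equal maps give
     equal operations. *)
  have actE w (X : wp V) q :
      sval (act w X) q <-> V q /\ sval X (q \o word_fun w).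
    elim: w q => [|g w IHw] q /=.
      by split=> [Xq|[]//]; split=> //; exact: (svalP X).
    split=> [[Vq /IHw[]//]|[Vq Xq]]; split=> //.
    by apply/IHw; split=> //; exact: Vsq.
  apply: wp_ext => q Vq; rewrite /= !eval_word_term !actE.
  by rewrite (funext (word_fun_map_eq rho_inj uv)).
- have := Vsq _ _ (gen_map rho_inj g).
  by move: eq0P => /= [<-|[<-|//]] Vg; apply: wp_ext => q Vq /=;
    have := Vg q Vq; tauto.
- apply: wp_ext => q Vq.
  (* Each Boolean axiom becomes a propositional tautology in the three memberships at [q]. *)
  have := EM (sval (e 0) q); have := EM (sval (e 1) q); have := EM (sval (e 2) q).
  by move: eq0P => /=; do !(case=> [<-|]) => //=; tauto.
Qed.

End Infinite.

Theorem corollary3p35 (d : Order.disp_t) (alpha : orderType d)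
    (alpha_wo : well_order (<=%O : rel alpha))
    (alpha_inf : infinite_set [set: alpha]%classic)
    (R : forall n : nat, relations n)
    (R_pres : forall n : nat, (2 <= n)%N -> presents_transformations (R n)) :
  [/\ WSA alpha ≡ Mod (Sigma R alpha),
      Mod (Sigma R alpha) ≡ opH (opS (opP (wp_Id_class alpha)))
    & opH (opS (opP (wp_Id_class alpha))) ≡ opS (opP (full_wp_class alpha))].
Proof.
have Id_sq := @Id_space_locally_square alpha.
have Mod_var := Mod_variety (Sigma R alpha).
have Mod_full A : Mod (Sigma R alpha) A -> opS (opP (full_wp_class alpha)) A.
  move=> AM; apply: (opSP_separated (B := wp [set: alpha -> alpha]%classic)).
    by exists alpha.
  move=> x y /(separating_representation alpha_inf R_pres AM) [h hhom hxy].
  by exists h => // hE; apply: hxy; rewrite hE.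
have Mod_Id A : Mod (Sigma R alpha) A -> opH (opS (opP (wp_Id_class alpha))) A.
  move=> AM; apply/subclass_opH/(opSP_separated (B := wp (Id_space alpha))) => //.
  move=> x y /(separating_representation alpha_inf R_pres AM) [h hhom hxy].
  exists (@restrict _ (Id_space alpha) \o h).
    exact: is_hom_comp hhom (restrict_hom Id_sq).
  (* The separation takes place at the point [id], which lies in [Id_space alpha], so it survives
     restriction. *)
  have Id_id : Id_space alpha id by exact: sub_finite_set (@finite_set0 _).
  have restrictE X : sval (@restrict _ (Id_space alpha) X) id = sval X id.
    by apply/propext; split=> [[]|].
  by move=> hE; apply: hxy; rewrite -!restrictE; congr (sval _ id).
have full_Mod : subclass (full_wp_class alpha) (Mod (Sigma R alpha)).
  by move=> _ [U ->]; exact: wp_Sigma.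
have Id_Mod : subclass (wp_Id_class alpha) (Mod (Sigma R alpha)).
  by move=> _ ->; exact: wp_Sigma.
have Id_Mod' := opHSP_variety Mod_var Id_Mod.
split=> A; split=> [AP|AP].
- by apply: AP => // _ [V [_ Vsq ->]]; exact: wp_Sigma.
(* [wp (Id_space alpha)] is one of the generators of [WSA alpha], so its HSP closure lies in every
   variety containing them. *)
- move=> V Vvar KV; apply: (opHSP_variety Vvar _ (Mod_Id _ AP)) => _ ->.
  by apply: KV; exists (Id_space alpha); split.
- exact: Mod_Id.
- exact: Id_Mod'.
- exact/Mod_full/Id_Mod'.
- exact/Mod_Id/(opSP_variety Mod_var full_Mod).
Qed.
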